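(* Let $f:\mathbb{R}^m\to\mathbb{R}$ be continuously differentiable with Lipschitz continuous gradient with Lipschitz constant $L$. If $f$ is $\mathrm{RC}(\alpha,\beta)$ (with $\alpha,\beta>0$), then $f$ is $\frac{1}{\beta^2L}$-PL.
   Context: Norms are Euclidean. $f$ satisfies the Regularity Condition $\mathrm{RC}(\alpha,\beta)$ with $\alpha,\beta>0$ if $$\langle\nabla f(z),z-x^*\rangle\ge\frac1\alpha\|\nabla f(z)\|^2+\frac1\beta\|z-x^*\|^2$$ for all $z\in\mathbb{R}^m$, where $x^*$ is a minimizer of $f$. $f$ is $\mu$-PL, with $\mu>0$, if $\frac12\|\nabla f(z)\|^2\ge\mu(f(z)-f^* )$ for all $z\in\mathbb{R}^m$, where $f^*=\min_{x\in\mathbb{R}^m}f(x)$. *)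

(* Defs.v *)
From mathcomp Require Import all_boot all_order all_algebra.
From mathcomp Require Import all_classical all_reals all_analysis.
Import Order.TTheory GRing.Theory Num.Theory.
Import numFieldNormedType.Exports.

Set Implicit Arguments.
Unset Strict Implicit.
Unset Printing Implicit Defensive.

Local Open Scope ring_scope.
Local Open Scope classical_set_scope.

Section Definitions.
Variables (R : realType) (m : nat).
Implicit Types (u v x z : 'rV[R]_m) (f : 'rV[R]_m -> R).

Definition dot u v : R := \sum_(i < m) u 0 i * v 0 i.

(* The norm `|u| of the normed module 'rV[R]_m is the sup norm, so the
   Euclidean norm is defined separately; both induce the same topology and
   the same notion of differentiability. *)
Definition enorm u : R := Num.sqrt (dot u u).

Definition gradient f z : 'rV[R]_m := \row_(i < m) 'D_(delta_mx 0 i) f z.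

Definition continuously_differentiable f : Prop :=
  (forall z, differentiable f z) /\ continuous (gradient f).

Definition lipschitz_gradient (L : R) f : Prop :=
  forall x z, enorm (gradient f x - gradient f z) <= L * enorm (x - z).

Definition is_minimizer f x : Prop := forall z, f x <= f z.

Definition RC (alpha beta : R) f : Prop :=
  [/\ 0 < alpha, 0 < beta &
    exists2 xstar, is_minimizer f xstar &
      forall z, dot (gradient f z) (z - xstar) >=
        alpha^-1 * enorm (gradient f z) ^+ 2 + beta^-1 * enorm (z - xstar) ^+ 2].

(* The minimum value f^* is f xstar for any minimizer xstar; its existence is
   part of the definition. *)
Definition PL (mu : R) f : Prop :=
  0 < mu /\
    exists2 xstar, is_minimizer f xstar &
      forall z, 2^-1 * enorm (gradient f z) ^+ 2 >= mu * (f z - f xstar).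

End Definitions.

(* Main.v *)
Require Import Defs.
From mathcomp Require Import all_boot all_order all_algebra.
From mathcomp Require Import all_classical all_reals all_analysis.
From mathcomp Require Import ring lra.
Import Order.TTheory GRing.Theory Num.Theory.
Import numFieldNormedType.Exports.
Local Open Scope ring_scope.

(** Write x for the minimizer, d = z - x and g for the gradient of f.  The
    regularity condition at x forces g x = 0, so the Lipschitz bound gives
    f z - f x <= L/2 |d|^2 (mean value theorem on the segment from x to z),
    and the regularity condition at z gives |d| <= beta |g z|.  Positivity of
    L holds because g z <> 0 for z <> x, and such a z exists as m > 0. *)

Section Dot.
Context {R : realType} {m : nat}.
Implicit Types (u v : 'rV[R]_m) (s : R).

Lemma dot_ge0 u : 0 <= dot u u.
Proof. by apply: sumr_ge0 => i _; rewrite -expr2 sqr_ge0. Qed.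

Lemma enorm_ge0 u : 0 <= enorm u.
Proof. exact: sqrtr_ge0. Qed.

Lemma sqr_enorm u : enorm u ^+ 2 = dot u u.
Proof. by rewrite /enorm sqr_sqrtr ?dot_ge0. Qed.

Lemma dot0r u : dot u 0 = 0.
Proof. by apply: big1 => i _; rewrite mxE mulr0. Qed.

Lemma dotZZ s u : dot (s *: u) (s *: u) = s ^+ 2 * dot u u.
Proof. by rewrite /dot mulr_sumr; apply: eq_bigr => i _; rewrite !mxE; ring. Qed.

Lemma dot_eq0 u : (dot u u == 0) = (u == 0).
Proof.
apply/eqP/eqP => [|->]; last exact: dot0r.
move=> /eqP; rewrite psumr_eq0 => [/allP u0|i _]; last by rewrite -expr2 sqr_ge0.
apply/rowP => i; rewrite mxE; apply/eqP.
by have := u0 i (mem_index_enum i); rewrite /= mulf_eq0 orbb.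
Qed.

Lemma enorm0 : enorm (0 : 'rV[R]_m) = 0.
Proof. by rewrite /enorm dot0r sqrtr0. Qed.

(** Expand [dot (u - s *: v) (u - s *: v) >= 0]. With [s] suitably chosen, this does the work of
    Cauchy-Schwarz without square roots. *)
Lemma dot_young s u v : 2 * s * dot u v <= dot u u + s ^+ 2 * dot v v.
Proof.
rewrite -subr_ge0.
suff -> : dot u u + s ^+ 2 * dot v v - 2 * s * dot u v = dot (u - s *: v) (u - s *: v).
  exact: dot_ge0.
rewrite /dot !mulr_sumr -big_split -sumrB; apply: eq_bigr => i _.
by rewrite !mxE /=; ring.
Qed.

End Dot.

Section Descent.
Context {R : realType} {m : nat} {f : 'rV[R]_m -> R}.
Implicit Types (x z d : 'rV[R]_m).

Lemma derive_gradient z d : differentiable f z -> 'D_d f z = dot (gradient f z) d.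
Proof.
move=> df; rewrite deriveE// {1}(row_sum_delta d) linear_sum.
by apply: eq_bigr => i _; rewrite linearZ /= -deriveE// mxE mulrC.
Qed.

Lemma is_derive_line x d (t : R) : differentiable f (x + t *: d) ->
  is_derive t 1 (fun s : R => f (x + s *: d)) (dot (gradient f (x + t *: d)) d).
Proof.
move=> df.
(* The difference quotient of the line function at [t] is that of [f] at [x + t *: d] in direction
   [d], so no chain rule is invoked. *)
have quotE : (fun h : R => h^-1 *: (f (x + (h *: 1 + t) *: d) - f (x + t *: d)))
    = (fun h : R => h^-1 *: (f (h *: d + (x + t *: d)) - f (x + t *: d))).
  by apply: funext => h; rewrite scalerDl /GRing.scale/= mulr1 addrCA.
have /(_ d) dfd := @diff_derivable _ _ _ f (x + t *: d) ^~ df.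
apply: DeriveDef.
  by rewrite /derivable /= quotE; exact: dfd.
by rewrite -derive_gradient// /derive /= quotE.
Qed.

Lemma descent_from_critical_point {L : R} {x} d :
    (forall z, differentiable f z) -> lipschitz_gradient L f -> 0 < L ->
    gradient f x = 0 ->
  f (x + d) - f x <= L / 2 * dot d d.
Proof.
move=> df lip L0 gx0.
pose D := dot d d.
pose g (t : R) := f (x + t *: d).
pose g' (t : R) := dot (gradient f (x + t *: d)) d.
(* [q] is the primitive of [L * D * t]. Applying the mean value theorem to [g - q] rather than to
   [g] yields the sharp factor 1/2: the derivative of [g - q] is nonpositive on the open unit
   interval, and [q 1 - q 0] is [L / 2 * D]. *)
pose q (t : R) := L / 2 * D * t ^+ 2.
have gd (t : R) : is_derive t 1 g (g' t) by exact: is_derive_line.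
have qd (t : R) : is_derive t 1 q (L * D * t).
  apply: is_derive_eq; rewrite /GRing.scale/=; by field.
have hd (t : R) : is_derive t 1 (g - q) (g' t - L * D * t) by apply: is_deriveB.
have hc : {within `[0, 1], continuous (g - q)}%classic.
  apply: continuous_subspaceT => t; apply: differentiable_continuous.
  by apply/derivable1_diffP; case: (hd t).
have [c] := MVT ltr01 (fun t _ => hd t) hc.
rewrite in_itv/= => /andP[c0 c1] hE.
have gc : g' c <= L * D * c.
  have := lip (x + c *: d) x; rewrite gx0 subr0 addrAC subrr add0r => lipc.
  have lipc2 : dot (gradient f (x + c *: d)) (gradient f (x + c *: d))
      <= (L * c) ^+ 2 * D.
    have : enorm (gradient f (x + c *: d)) ^+ 2 <= (L * enorm (c *: d)) ^+ 2.
      by rewrite ler_sqr ?nnegrE ?mulr_ge0 ?enorm_ge0// ltW.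
    by rewrite exprMn !sqr_enorm dotZZ mulrA -exprMn.
  (* With [s = L * c] both terms on the right are at most [(L * c) ^+ 2 * D]; dividing by
     [2 * (L * c)], positive since [c] is interior, bounds [g' c]. *)
  have := dot_young (L * c) (gradient f (x + c *: d)) d.
  rewrite -/D -/(g' c) => young.
  have Lc : 0 < 2 * (L * c) by rewrite !mulr_gt0.
  rewrite -(ler_pM2l Lc); lra.
move: hE; rewrite !fctE /g /q scale1r scale0r addr0 -/D; lra.
Qed.

End Descent.

Section RegularityCondition.
Context {R : realType} {m : nat}.
Context {f : 'rV[R]_m -> R} {alpha beta : R} {x : 'rV[R]_m}.
Hypotheses (alpha0 : 0 < alpha) (beta0 : 0 < beta).
Hypothesis rc : forall z, dot (gradient f z) (z - x) >=
  alpha^-1 * enorm (gradient f z) ^+ 2 + beta^-1 * enorm (z - x) ^+ 2.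

(** At [z = x] the inner product and the distance vanish, leaving [alpha^-1] times the squared
    gradient norm at most 0. *)
Lemma RC_gradient_center : gradient f x = 0.
Proof.
have := rc x; rewrite subrr enorm0 expr0n mulr0 addr0 dot0r sqr_enorm.
rewrite pmulr_rle0 ?invr_gt0// => le0.
by apply/eqP; rewrite -dot_eq0 eq_le le0 dot_ge0.
Qed.

Lemma RC_error_bound z :
  dot (z - x) (z - x) <= beta ^+ 2 * dot (gradient f z) (gradient f z).
Proof.
have := rc z; rewrite !sqr_enorm.
(* With [s = beta^-1] this reads 2p/beta <= G + D/beta^2, while [rcz] gives p >= D/beta; together
   they yield D/beta^2 <= G. *)
have := dot_young beta^-1 (gradient f z) (z - x).
have := dot_ge0 (gradient f z).
set G := dot (gradient f z) _; set D := dot (z - x) _; set p := dot _ _.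
move=> G0 young rcz.
have b0 : 0 < beta^-1 by rewrite invr_gt0.
have le_p : beta^-1 * D <= p.
  by apply: le_trans rcz; rewrite lerDr mulr_ge0// invr_ge0 ltW.
have : beta^-1 * (beta^-1 * D) <= beta^-1 * p by rewrite ler_pM2l.
move=> le2; have le3 : beta^-1 ^+ 2 * D <= G by lra.
by rewrite -ler_pdivrMl ?exprn_gt0// -exprVn.
Qed.

(** If [L <= 0], the gradient vanishes at [x + e] as it does at [x], and the error bound then forces
    [e = 0]; the all-ones vector contradicts this once [0 < m]. *)
Lemma RC_lipschitz_gt0 {L : R} : (0 < m)%N -> lipschitz_gradient L f -> 0 < L.
Proof.
move=> m0 lip; rewrite ltNge; apply/negP => L0.
pose e : 'rV[R]_m := const_mx 1.
have e0 : e != 0.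
  by apply/eqP => /rowP /(_ (Ordinal m0)); rewrite !mxE; apply/eqP/oner_neq0.
have := lip (x + e) x; rewrite RC_gradient_center subr0 => lipe.
have G0 : enorm (gradient f (x + e)) = 0.
  apply/eqP; rewrite eq_le enorm_ge0 andbT (le_trans lipe)//.
  by rewrite mulr_le0_ge0 ?enorm_ge0.
have := RC_error_bound (x + e).
rewrite -(sqr_enorm (gradient f _)) G0 expr0n mulr0 addrAC subrr add0r.
by move=> le0; move: e0; rewrite -dot_eq0 eq_le le0 dot_ge0.
Qed.

End RegularityCondition.

Theorem lemma1 (R : realType) (m : nat) (m_gt0 : (0 < m)%N)
    (f : 'rV[R]_m -> R) (L alpha beta : R)
    (f_C1 : continuously_differentiable f)
    (f_lip : lipschitz_gradient L f)
    (f_RC : RC alpha beta f) :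
  PL (1 / (beta ^+ 2 * L)) f.
Proof.
case: f_C1 => df _; case: f_RC => alpha0 beta0 [x minx rc].
have L0 : 0 < L := RC_lipschitz_gt0 alpha0 beta0 rc m_gt0 f_lip.
have bL0 : 0 < beta ^+ 2 * L by rewrite mulr_gt0// exprn_gt0.
split; first by rewrite div1r invr_gt0.
exists x => // z; rewrite div1r ler_pdivrMl// sqr_enorm.
have := descent_from_critical_point (z - x) df f_lip L0 (RC_gradient_center alpha0 rc).
rewrite (addrC x) subrK => /le_trans; apply.
have L2 : 0 < L / 2 by rewrite divr_gt0.
(* Scaling the error bound by [L / 2] turns the quadratic upper bound into [beta ^+ 2 * L] times
   half the squared gradient norm. *)
have := RC_error_bound alpha0 beta0 rc z; rewrite -(ler_pM2l L2); lra.
Qed.
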